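(* Let $G$ be a graph of order $n_0>2$ and size $m_0$ with minimum degree $\delta\ge \frac{n_0}{2}+1$. Then the iterated line graphs $\mathcal{L}^k(G)$ have property $\varrho$ for every $k\ge 1$.
   Context: $\mathcal{L}^k$ is the $k$-th iterated line graph. A graph has property $\varrho$ if all its negative adjacency eigenvalues equal $-2$. *)

(* Defs.v *)
From HB Require Import structures.
From mathcomp Require Import all_boot all_order all_algebra.
From mathcomp Require Import reals.
Set Implicit Arguments.
Unset Strict Implicit.
Unset Printing Implicit Defensive.
Import Order.TTheory GRing.Theory Num.Theory.
Local Open Scope ring_scope.

(* Bundled, because the vertex type changes when the line graph is iterated. *)
Record sgraph := SGraph {
  vertex :> finType;
  adj : rel vertex;
  adj_sym : symmetric adj;
  adj_irrefl : irreflexive adj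
}.

Definition edges (G : sgraph) : {set {set G}} :=
  [set e : {set G} | [exists x : G, exists y : G, adj x y && (e == [set x; y])]].

Definition graph_order (G : sgraph) : nat := #|G|.

Definition graph_size (G : sgraph) : nat := #|edges G|.

Definition degree (G : sgraph) (x : G) : nat := #|[set y : G | adj x y]|.

(* Every degree is smaller than #|G|, so the default value #|G| of the big minimum
   is only reached by the graph without vertices. *)
Definition min_degree (G : sgraph) : nat :=
  \big[minn/#|G|]_(x : G) degree x.

Definition line_adj (G : sgraph) : rel {e : {set G} | e \in edges G} :=
  fun e f => (e != f) && (val e :&: val f != set0).

Lemma line_adj_sym (G : sgraph) : symmetric (@line_adj G).
Proof. by move=> e f; rewrite /line_adj eq_sym setIC. Qed.

Lemma line_adj_irrefl (G : sgraph) : irreflexive (@line_adj G).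
Proof. by move=> e; rewrite /line_adj eqxx. Qed.

Definition line_graph (G : sgraph) : sgraph :=
  SGraph (@line_adj_sym G) (@line_adj_irrefl G).

Definition iterated_line_graph (k : nat) (G : sgraph) : sgraph :=
  iter k line_graph G.

Definition adjacency_matrix (R : realType) (G : sgraph) : 'M[R]_#|G| :=
  \matrix_(i, j) (adj (enum_val i) (enum_val j))%:R.

Definition property_rho (R : realType) (G : sgraph) : Prop :=
  forall a : R, eigenvalue (adjacency_matrix R G) a -> a < 0 -> a = - 2%:R.

(* Main.v *)
Require Import Defs.
From mathcomp Require Import all_boot all_order all_algebra.
From mathcomp Require Import reals.
From mathcomp Require Import zify ring lra.
Import Order.TTheory GRing.Theory Num.Theory.
Local Open Scope ring_scope.

(** Let [B] be the incidence matrix of [H] and [Q = D + A = B B^T] its signless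
    Laplacian. The line graph has adjacency matrix [B^T B - 2], so each of its
    eigenvalues [a <> -2] gives the nonzero eigenvalue [a + 2] of [Q]. Hence [L(H)]
    has property rho as soon as [Q >= 2], which is shown in two ways.
    - If every degree [d] of [H] satisfies [2 d >= n + 2], write
      [Q = J + (D - 1 - A')] with [A'] the adjacency matrix of the complement; [J >= 0],
      and [D - 1 - A' >= 2] by diagonal dominance.
    - If [H] is itself a line graph, [A >= -2], so [Q >= 2] once all degrees are at
      least 4. This bound is inherited by the line graph, where the degree of the edge
      [uv] is [d u + d v - 2]. *)

(** The quadratic form [x^T Q x]; [Q >= 2] is expressed as a lower bound on it. *)
Definition signless_form {R : realType} {G : sgraph} (x : G -> R) : R :=
  \sum_u (degree u)%:R * x u ^+ 2 + \sum_u \sum_v (adj u v)%:R * (x u * x v).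

(** * Edges as two-element sets, and counts of their incidences *)

Lemma line_vertexP {G : sgraph} (e : line_graph G) :
  exists u v : G, [/\ adj u v, u != v & val e = [set u; v]].
Proof.
case: e => e /= ee; move: (ee); rewrite inE => /existsP[u /existsP[v /andP[uv /eqP ->]]].
exists u, v; split=> //; apply/eqP => euv; by rewrite euv adj_irrefl in uv.
Qed.

Lemma edge_in_edges {G : sgraph} {u v : G} : adj u v -> [set u; v] \in edges G.
Proof.
by move=> uv; rewrite inE; apply/existsP; exists u; apply/existsP; exists v; rewrite uv eqxx.
Qed.

Definition edge_of {G : sgraph} {u v : G} (uv : adj u v) : line_graph G :=
  exist (fun e => e \in edges G) [set u; v] (edge_in_edges uv).

Lemma card_edge {G : sgraph} (e : line_graph G) : #|val e| = 2%N.
Proof. by have [u [v [_ uv ->]]] := line_vertexP e; rewrite cards2 uv. Qed.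

Lemma edge_eq_pair {G : sgraph} {e : line_graph G} {u v : G} :
  u != v -> u \in val e -> v \in val e -> val e = [set u; v].
Proof.
move=> uv ue ve; apply/esym/eqP; rewrite eqEcard cards2 uv card_edge andbT.
by apply/subsetP => w /set2P[] ->.
Qed.

(** Two edges with two common endpoints coincide, so distinct ones share at most one. This is
    [B^T B = 2 + A] for the line graph, entry by entry. *)
Lemma card_edgeI {G : sgraph} (e f : line_graph G) :
  #|val e :&: val f| = (2 * (e == f) + adj e f)%N.
Proof.
rewrite /= /line_adj; have [<-|ef] := eqVneq e f; first by rewrite setIid card_edge.
rewrite -card_gt0 /= muln0 add0n.
suff: (#|val e :&: val f| < 2)%N by case: #|_| => [|[]].
rewrite ltnNge; apply/negP => le2.
have ief : val e :&: val f = val e by apply/eqP; rewrite eqEcard subsetIl card_edge.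
have ife : val e :&: val f = val f by apply/eqP; rewrite eqEcard subsetIr card_edge.
by move/eqP: ef; apply; apply: val_inj; rewrite -ief -{2}ife.
Qed.

Lemma card_edges_at {G : sgraph} (u : G) :
  #|[set e : line_graph G | u \in val e]| = degree u.
Proof.
rewrite /degree -(card_imset _ val_inj).
(* The edges at [u] are the images of its neighbours under [v |-> {u, v}]. *)
have inj : {in [set v | adj u v] &, injective (fun v : G => [set u; v])}.
  move=> v w; rewrite !inE => uv uw /setP /(_ v).
  rewrite !inE eqxx orbT => /esym /orP[] /eqP // evu.
  by rewrite evu adj_irrefl in uv.
rewrite -(card_in_imset inj); apply: eq_card => s; apply/imsetP/imsetP.
  move=> [e]; rewrite inE => ue ->.
  have [a [b [ab nab ee]]] := line_vertexP e.
  move: ue; rewrite ee => /set2P[] ->; first by exists b; rewrite ?inE.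
  by exists a; rewrite ?inE 1?adj_sym // setUC.
move=> [v]; rewrite inE => uv ->.
by exists (edge_of uv); rewrite ?inE //= eqxx.
Qed.

Lemma card_edges_at2 {G : sgraph} {u v : G} : u != v ->
  #|[set e : line_graph G | (u \in val e) && (v \in val e)]| = adj u v.
Proof.
move=> nuv; case uv: (adj u v).
  apply/eqP/cards1P; exists (edge_of uv); apply/setP => e.
  rewrite !inE; apply/idP/eqP => [/andP[ue ve]|->]; last by rewrite /= !inE !eqxx orbT.
  by apply: val_inj; rewrite /=; apply: edge_eq_pair.
apply/eqP; rewrite cards_eq0 -subset0; apply/subsetP => e; rewrite inE => /andP[ue ve].
have [a [b [ab _ ee]]] := line_vertexP e.
move: ue ve; rewrite ee => /set2P[] eu /set2P[] ev; subst.
- by rewrite eqxx in nuv.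
- by rewrite ab in uv.
- by rewrite adj_sym ab in uv.
- by rewrite eqxx in nuv.
Qed.

(** * The incidence matrix and its two Gram matrices *)

Lemma sum_indicator {R : realType} {T : finType} (P : pred T) :
  \sum_t (P t)%:R = #|[set t | P t]|%:R :> R.
Proof. by rewrite -natr_sum -big_mkcond /= sum1dep_card. Qed.

Definition incidence (R : realType) {G : sgraph} (u : G) (e : line_graph G) : R :=
  (u \in val e)%:R.

Lemma incidence_gram_edges (R : realType) {G : sgraph} (e f : line_graph G) :
  \sum_u incidence R u e * incidence R u f = 2%:R * (e == f)%:R + (adj e f)%:R.
Proof.
under eq_bigr do rewrite /incidence -natrM mulnb.
rewrite (sum_indicator (fun u => (u \in val e) && (u \in val f))).
by rewrite -natrM -natrD -card_edgeI.
Qed.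

Lemma incidence_gram_vertices (R : realType) {G : sgraph} (u v : G) :
  \sum_e incidence R u e * incidence R v e = (degree u)%:R * (u == v)%:R + (adj u v)%:R.
Proof.
under eq_bigr do rewrite /incidence -natrM mulnb.
rewrite (sum_indicator (fun e : line_graph G => (u \in val e) && (v \in val e))).
have [<-|uv] := eqVneq u v.
  rewrite adj_irrefl mulr1 addr0 -card_edges_at; congr _%:R.
  by apply: eq_card => e; rewrite !inE andbb.
by rewrite mulr0 add0r (card_edges_at2 uv).
Qed.

(** The identity [|B^T x|^2 = x^T (B B^T) x], stated for any [B] so that it serves both the
    incidence matrix and its transpose. *)
Lemma sum_sqr_gram {R : realType} {T U : finType} (B : T -> U -> R) (x : T -> R) :
  \sum_u (\sum_t B t u * x t) ^+ 2 =
  \sum_s \sum_t (\sum_u B s u * B t u) * (x s * x t).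
Proof.
under eq_bigr do rewrite expr2 big_distrlr /=.
rewrite exchange_big /=; apply: eq_bigr => s _.
rewrite exchange_big /=; apply: eq_bigr => t _.
by rewrite mulr_suml; apply: eq_bigr => u _; ring.
Qed.

Lemma sum_diagD {R : realType} {T : finType} (c : T -> R) (A : T -> T -> R) (x : T -> R) :
  \sum_s \sum_t (c s * (s == t)%:R + A s t) * (x s * x t) =
  \sum_s c s * x s ^+ 2 + \sum_s \sum_t A s t * (x s * x t).
Proof.
rewrite -big_split /=; apply: eq_bigr => s _.
under eq_bigr do rewrite mulrDl.
rewrite big_split /= (bigD1 s) //= eqxx mulr1 expr2 big1 ?addr0 // => t ts.
by rewrite eq_sym (negPf ts) mulr0 mul0r.
Qed.

Lemma signless_formE {R : realType} {G : sgraph} (x : G -> R) :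
  signless_form x = \sum_e (\sum_u incidence R u e * x u) ^+ 2.
Proof.
rewrite sum_sqr_gram.
under [RHS]eq_bigr do under eq_bigr do rewrite incidence_gram_vertices.
by rewrite sum_diagD.
Qed.

Lemma line_adj_form {R : realType} {G : sgraph} (y : line_graph G -> R) :
  \sum_e \sum_f (adj e f)%:R * (y e * y f) =
  \sum_u (\sum_e incidence R u e * y e) ^+ 2 - 2%:R * \sum_e y e ^+ 2.
Proof.
rewrite (sum_sqr_gram (fun e u => incidence R u e)).
under [in RHS]eq_bigr do under eq_bigr do rewrite incidence_gram_edges.
by rewrite sum_diagD mulr_sumr addrC addKr.
Qed.

(** Double counting of the pairs [(f, u)] with [u] a common endpoint of [e] and [f]; the 2 is the
    contribution of [f = e]. *)
Lemma line_degree {G : sgraph} (e : line_graph G) :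
  (degree e + 2 = \sum_(u in val e) degree u)%N.
Proof.
rewrite -[in RHS](eq_bigr _ (fun u _ => card_edges_at u)).
transitivity (\sum_(f : line_graph G) #|val e :&: val f|)%N.
  under eq_bigr do rewrite card_edgeI.
  rewrite big_split /= -big_distrr /= (bigD1 e) //= eqxx big1 ?addn0; last first.
    by move=> f; rewrite eq_sym => /negPf ->.
  by rewrite muln1 addnC -big_mkcond /= sum1dep_card.
under eq_bigr do rewrite -sum1_card big_mkcond.
rewrite exchange_big /= [RHS]big_mkcond /=; apply: eq_bigr => u _.
under eq_bigr do rewrite inE.
case: (u \in val e) => /=; last by rewrite big1.
by rewrite -big_mkcond /= sum1dep_card.
Qed.

Lemma line_degree_ge {G : sgraph} {d : nat} :
  (forall u : G, d <= degree u)%N ->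
  forall e : line_graph G, (2 * d - 2 <= degree e)%N.
Proof.
move=> hd e; rewrite leq_subLR addnC line_degree.
rewrite -(card_edge e) -sum_nat_const; exact: leq_sum.
Qed.

(** * From a bound on the signless Laplacian to property rho *)

Lemma eigenvalue_adjacencyP {R : realType} {G : sgraph} {a : R} :
  eigenvalue (adjacency_matrix R G) a ->
  exists y : G -> R, (exists e, y e != 0) /\
    forall e, \sum_f (adj f e)%:R * y f = a * y e.
Proof.
case/eigenvalueP => v hv v0; exists (fun e => v 0 (enum_rank e)); split.
  by have /rV0Pn[i vi] := v0; exists (enum_val i); rewrite enum_valK.
move=> e; have := congr1 (fun w : 'rV_ _ => w 0 (enum_rank e)) hv.
rewrite !mxE => <-; rewrite (reindex enum_rank) /=; last first.
  by apply: onW_bij; apply: enum_rank_bij.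
by apply: eq_bigr => f _; rewrite !mxE !enum_rankK mulrC.
Qed.

Lemma sum_sqr_gt0 {R : realType} {T : finType} {x : T -> R} {t : T} :
  x t != 0 -> 0 < \sum_s x s ^+ 2.
Proof.
move=> xt; rewrite (bigD1 t) //= ltr_pwDl //.
  by rewrite lt_def sqrf_eq0 xt sqr_ge0.
by apply: sumr_ge0 => s _; apply: sqr_ge0.
Qed.

(** For an eigenvector [y] of the line graph, [x = B y] satisfies [B^T x = (a + 2) y], hence
    [x^T Q x = (a + 2) |x|^2]. *)
Lemma line_graph_rho (R : realType) (G : sgraph) :
  (forall x : G -> R, 2%:R * \sum_u x u ^+ 2 <= signless_form x) ->
  property_rho R (line_graph G).
Proof.
move=> hQ a /eigenvalue_adjacencyP[y [[e0 ye0] hy]] a0.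
pose x u := \sum_e incidence R u e * y e.
have hx e : \sum_u incidence R u e * x u = (a + 2%:R) * y e.
  under eq_bigr do rewrite mulr_sumr.
  rewrite exchange_big /=.
  transitivity (\sum_f (2%:R * (f == e)%:R * y f + (adj f e)%:R * y f)).
    apply: eq_bigr => f _; rewrite -mulrDl -incidence_gram_edges mulr_suml.
    by apply: eq_bigr => u _; ring.
  rewrite big_split /= hy mulrDl addrC; congr (_ + _).
  rewrite (bigD1 e) //= eqxx mulr1 big1 ?addr0 // => f /negPf ->.
  by rewrite mulr0 mul0r.
have Qx : signless_form x = (a + 2%:R) * \sum_u x u ^+ 2.
  rewrite signless_formE.
  transitivity (\sum_e \sum_u (a + 2%:R) * (x u * (incidence R u e * y e))).
    apply: eq_bigr => e _; rewrite expr2 {1}hx mulr_sumr.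
    by apply: eq_bigr => u _; ring.
  rewrite exchange_big mulr_sumr /=; apply: eq_bigr => u _.
  by rewrite -mulr_sumr -mulr_sumr expr2.
have [/existsP[u xu]|/existsPn x0] := boolP [exists u, x u != 0].
  (* Here [x] is nonzero, so the bound forces [a + 2 >= 2], against [a < 0]. *)
  have := sum_sqr_gt0 xu; have := hQ x; rewrite Qx; nra.
(* Here [x = 0], so [(a + 2) * y e0 = 0] with [y e0 != 0]. *)
have := hx e0; rewrite big1 => [|u _]; last first.
  by move: (x0 u); rewrite negbK => /eqP ->; rewrite mulr0.
move/esym/eqP; rewrite mulf_eq0 (negPf ye0) orbF => /eqP; lra.
Qed.

(** * The two sources of the bound [Q >= 2] *)

Lemma signless_form_dense (R : realType) (G : sgraph) :
  (forall u : G, #|G| + 2 <= 2 * degree u)%N ->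
  forall x : G -> R, 2%:R * \sum_u x u ^+ 2 <= signless_form x.
Proof.
move=> hd x.
(* The adjacency matrix of the complement graph. *)
pose co (u v : G) : R := 1 - (u == v)%:R - (adj u v)%:R.
have co_ge0 u v : 0 <= co u v.
  rewrite /co; have [<-|_] := eqVneq u v; first by rewrite adj_irrefl /=; lra.
  by case: (adj u v) => /=; lra.
have co_sym u v : co u v = co v u by rewrite /co eq_sym adj_sym.
have co_sum u : \sum_v co u v = #|G|%:R - 1 - (degree u)%:R.
  rewrite !sumrB sumr_const (sum_indicator (adj u)); congr (_ - _ - _).
  rewrite (bigD1 u) //= eqxx big1 ?addr0 // => v /negPf.
  by rewrite eq_sym => ->.
(* Diagonal dominance: bound [x u * x v] by the mean of the two squares, then use the symmetry of
   [co]. *)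
have co_form : \sum_u \sum_v co u v * (x u * x v) <= \sum_u (\sum_v co u v) * x u ^+ 2.
  have sym : \sum_u \sum_v co u v * x v ^+ 2 = \sum_u (\sum_v co u v) * x u ^+ 2.
    rewrite exchange_big /=; apply: eq_bigr => u _; rewrite mulr_suml.
    by apply: eq_bigr => v _; rewrite co_sym.
  have -> : \sum_u (\sum_v co u v) * x u ^+ 2 =
      \sum_u \sum_v co u v * ((x u ^+ 2 + x v ^+ 2) / 2%:R).
    transitivity ((\sum_u (\sum_v co u v) * x u ^+ 2
                   + \sum_u \sum_v co u v * x v ^+ 2) / 2%:R).
      by rewrite sym; lra.
    rewrite -big_split mulr_suml /=; apply: eq_bigr => u _.
    rewrite mulr_suml -big_split mulr_suml /=; apply: eq_bigr => v _; lra.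
  apply: ler_sum => u _; apply: ler_sum => v _; apply: ler_wpM2l => //.
  have := sqr_ge0 (x u - x v); nra.
have all_form : \sum_u \sum_v (adj u v)%:R * (x u * x v) =
    (\sum_u x u) ^+ 2 - \sum_u x u ^+ 2 - \sum_u \sum_v co u v * (x u * x v).
  have -> : (\sum_u x u) ^+ 2 =
      \sum_u \sum_v (1 * (u == v)%:R + (co u v + (adj u v)%:R)) * (x u * x v).
    rewrite expr2 big_distrlr /=; apply: eq_bigr => u _; apply: eq_bigr => v _.
    by rewrite /co; ring.
  have coD : \sum_u \sum_v (co u v + (adj u v)%:R) * (x u * x v) =
      \sum_u \sum_v co u v * (x u * x v) + \sum_u \sum_v (adj u v)%:R * (x u * x v).
    rewrite -big_split; apply: eq_bigr => u _; rewrite -big_split.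
    by apply: eq_bigr => v _; rewrite mulrDl.
  by rewrite (sum_diagD (fun=> 1)) coD -[X in X + _ - _ - _]mulr_sumr; ring.
rewrite /signless_form all_form.
have sq := sqr_ge0 (\sum_u x u).
(* After dropping the square of the sum, the coefficient of [x u ^+ 2] is
   [d - 1 - (n - 1 - d) = 2 d - n], which is at least 2. *)
suff : 2%:R * \sum_u x u ^+ 2 <= \sum_u (degree u)%:R * x u ^+ 2 - \sum_u x u ^+ 2
    - \sum_u (\sum_v co u v) * x u ^+ 2 by lra.
rewrite mulr_sumr -!sumrB; apply: ler_sum => u _; rewrite co_sum.
have : (#|G| + 2)%:R <= (2 * degree u)%:R :> R by rewrite ler_nat.
rewrite natrD natrM; have := sqr_ge0 (x u); nra.
Qed.

Lemma signless_form_line (R : realType) (G : sgraph) :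
  (forall e : line_graph G, 4 <= degree e)%N ->
  forall y : line_graph G -> R, 2%:R * \sum_e y e ^+ 2 <= signless_form y.
Proof.
move=> hd y; rewrite /signless_form line_adj_form.
have h : 0 <= \sum_u (\sum_e incidence R u e * y e) ^+ 2.
  by apply: sumr_ge0 => u _; apply: sqr_ge0.
suff : 4%:R * \sum_e y e ^+ 2 <= \sum_e (degree e)%:R * y e ^+ 2 by lra.
rewrite mulr_sumr; apply: ler_sum => e _; apply: ler_wpM2r; first exact: sqr_ge0.
by rewrite ler_nat.
Qed.

(** A lower bound [d] on degrees becomes [2 d - 2], which sends 3 to 4 and 4 to 6. *)
Lemma iterated_line_degree (G : sgraph) (k : nat) :
  (forall u : G, 3 <= degree u)%N ->
  forall e : iterated_line_graph k.+1 G, (4 <= degree e)%N.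
Proof.
move=> h3; elim: k => [|k IH] e; first exact: (line_degree_ge h3).
by apply: leq_trans (line_degree_ge IH e).
Qed.

Lemma min_degree_le {G : sgraph} (u : G) : (min_degree G <= degree u)%N.
Proof.
rewrite /min_degree; elim: (index_enum G) (mem_index_enum u) => // w s IH.
rewrite inE big_cons geq_min => /predU1P[->|/IH ->]; first by rewrite leqnn.
by rewrite orbT.
Qed.

Theorem theorem4p14 (R : realType) (G : sgraph) (n0 m0 : nat)
    (hn : graph_order G = n0) (hm : graph_size G = m0) (hn2 : (2 < n0)%N)
    (hdelta : n0%:R / 2%:R + 1 <= (min_degree G)%:R :> R) :
  forall k : nat, (1 <= k)%N -> property_rho R (iterated_line_graph k G).
Proof.
have hd (u : G) : (#|G| + 2 <= 2 * degree u)%N.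
  apply: (leq_trans _ (leq_mul (leqnn 2) (min_degree_le u))).
  by rewrite -(ler_nat R) natrD natrM -/(graph_order G) hn; lra.
(* As [n0 >= 3], twice the degree is at least 5. *)
have h3 (u : G) : (3 <= degree u)%N.
  by have := hd u; rewrite -/(graph_order G) hn; lia.
(* For [k = 1] the root graph is the dense [G]; afterwards it is itself a line graph. *)
case=> [//|[|k]] _; apply: line_graph_rho; first exact: signless_form_dense.
exact/signless_form_line/(@iterated_line_degree G k h3).
Qed.
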